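(* No analytic filter $\mathcal F$ on $\omega$ admits an injective $\mathcal F$-convergent sequence in $\beta\omega$; that is, if $\mathcal F$ is a filter on $\omega$ which is analytic as a subset of the Cantor space $\mathcal P(\omega)$, then there is no injective sequence $\bar x=\langle x_n:n<\omega\rangle$ of points of $\beta\omega$ that has an $\mathcal F$-limit in $\beta\omega$.
   Context: A filter on $\omega$ is regarded as a subset of $\mathcal P(\omega)$, which is identified with the Cantor space $2^\omega$ (product topology) via characteristic functions; it is called analytic if it is an analytic subset of this space. A sequence $\langle x_n:n<\omega\rangle$ is injective if $x_n\neq x_k$ whenever $n\neq k$. For a topological space $X$, a sequence $\bar x=\langle x_n:n<\omega\rangle$ in $X$ and a point $x\in X$, $x$ is an $\mathcal F$-limit of $\bar x$ if for every neighbourhood $U$ of $x$ the set $\{n<\omega : x_n\in U\}$ belongs to $\mathcal F$. The space $\beta\omega$ is the Čech–Stone compactification of the discrete space $\omega$, identified with the set of all ultrafilters on $\omega$, with base of (clopen) sets $\hat A=\{p\in\beta\omega : A\in p\}$ for $A\subseteq\omega$.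
   Formalization: The filter is assumed to be proper and not a principal ultrafilter (it contains no singleton); for the improper filter and for the principal ultrafilter at n every sequence has a limit, so the claim fails exactly there. *)

(* Defs.v *)
From HB Require Import structures.
From mathcomp Require Import all_boot all_order all_algebra.
From mathcomp Require Import all_classical.
From mathcomp Require Import reals topology cantor.

Set Implicit Arguments.
Unset Strict Implicit.
Unset Printing Implicit Defensive.

Local Open Scope classical_set_scope.

(* omega^omega: [nat] carries its discrete topology. *)
Definition baire_space : Type := prod_topology (fun _ : nat => nat).

HB.instance Definition _ := Topological.on baire_space.

(* Intended for a Polish space T. *)
Definition analytic (T : topologicalType) (A : set T) : Prop :=
  A = set0 \/ exists2 f : baire_space -> T, continuous f & range f = A.

(* A family of subsets of omega, transported to the Cantor space along the
   identification of a subset with its characteristic function. *)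
Definition cantor_family (F : set_system nat) : set cantor_space :=
  [set c : cantor_space | F [set n | c n]].

Record beta_omega : Type := BetaOmega {
  beta_ultra : set_system nat;
  beta_ultraP : UltraFilter beta_ultra
}.

HB.instance Definition _ := gen_eqMixin beta_omega.
HB.instance Definition _ := gen_choiceMixin beta_omega.

Definition beta_hat (A : set nat) : set beta_omega :=
  [set p | beta_ultra p A].

Lemma beta_hat_cover : \bigcup_(A in [set: set nat]) beta_hat A = setT.
Proof.
apply/seteqP; split=> // -[p pU] _; exists setT => //=.
by rewrite /beta_hat /=; exact: filterT.
Qed.

Lemma beta_hat_join (A B : set nat) (p : beta_omega) :
  [set: set nat] A -> [set: set nat] B -> beta_hat A p -> beta_hat B p ->
  exists C, [/\ [set: set nat] C, beta_hat C p &
    beta_hat C `<=` beta_hat A `&` beta_hat B].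
Proof.
case: p => p pU _ _; rewrite /beta_hat /= => pA pB.
exists (A `&` B); split=> //=; first exact: filterI.
by move=> [q qU] /= qAB; split=> /=; apply: filterS qAB => ? [].
Qed.

HB.instance Definition _ :=
  isBaseTopological.Build beta_omega beta_hat_cover beta_hat_join.

(* Main.v *)
(* Suppose that [x] is injective and F-converges to [p]. For each [n] with
   [x n <> p] pick a set [U n] in [p] outside [x n], and let [h m] be the least
   [n] such that [m] is not in [U n]. The image ultrafilter [Q] of [p] by [h] is
   not principal, whereas the image of [x n] is principal, say at [g n]. By
   convergence, a set [B] is in [Q] iff [g @^-1` B], together with the at most
   one [n] such that [x n = p], is in [F]. So [Q] is a continuous preimage of
   [F], as is its complement, because complementing [B] exchanges the two. By
   Lusin separation [Q] then has the Baire property, which no nonprincipal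
   ultrafilter has. *)
Require Import Defs.
From mathcomp Require Import all_boot all_order all_algebra.
From mathcomp Require Import all_classical.
From mathcomp Require Import reals topology cantor.

Local Open Scope classical_set_scope.

(** * Finite agreement and the topology of sequence spaces *)

Definition agree {T : Type} (n : nat) (x y : nat -> T) : Prop :=
  forall i, (i < n)%N -> x i = y i.

Lemma agreeW {T : Type} {m n : nat} {x y : nat -> T} :
  (m <= n)%N -> agree n x y -> agree m x y.
Proof. by move=> mn xy i /leq_trans/(_ mn)/xy. Qed.

Lemma agree_trans {T : Type} {n : nat} {x y z : nat -> T} :
  agree n x y -> agree n y z -> agree n x z.
Proof. by move=> xy yz i ni; rewrite xy// yz. Qed.

Lemma eq_mkseq_agree {T : Type} {n : nat} {x y : nat -> T} :
  mkseq x n = mkseq y n -> agree n x y.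
Proof.
by move=> xy i ni; rewrite -(nth_mkseq (x i) x ni) xy nth_mkseq.
Qed.

Lemma nbhs_seqP {T : discreteTopologicalType}
    (x : prod_topology (fun _ : nat => T)) (A : set (nat -> T)) :
  nbhs x A <-> exists n, forall y, agree n x y -> A y.
Proof.
split=> [|[n xA]].
  pose G := filter_from [set: nat] (fun n => [set y : nat -> T | agree n x y]).
  have GF : Filter G.
    apply: filter_from_filter; first by exists 0%N.
    move=> i j _ _; exists (maxn i j) => // y xy.
    by split; apply: agreeW xy; rewrite ?leq_maxl ?leq_maxr.
  suff Gx : G --> x by move=> /Gx[n _ xA]; exists n.
  apply/cvg_sup => i C [_ [[B Bo <-] Bx] BC].
  exists i.+1 => // y xy; apply: BC.
  by move: Bx; rewrite /= xy.
have : nbhs x [set y : nat -> T | forall i : 'I_n, x i = y i].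
  apply: (@filter_forall (nat -> T) _ (fun (i : 'I_n) y => x i = y i) _
    (nbhs_filter x)) => i.
  apply: (@proj_continuous nat (fun=> T) i x [set t | x i = t]).
  by apply: filterS (discrete_set1 (x i)) => t ->.
apply: (@filterS _ _ (nbhs_filter x)) => y xy; apply: xA.
by move=> i ni; exact: (xy (Ordinal ni)).
Qed.

Lemma open_agree {T : discreteTopologicalType} (n : nat)
    (x : prod_topology (fun _ : nat => T)) :
  open ([set y | agree n x y] : set (prod_topology (fun _ : nat => T))).
Proof.
rewrite openE => y xy; apply/nbhs_seqP.
by exists n => z /(agree_trans xy).
Qed.

(** * Residual sets and the Baire property *)

Definition residual {T : topologicalType} (A : set T) : Prop :=
  exists2 D : nat -> set T,
    forall k, open (D k) /\ dense (D k) & \bigcap_k D k `<=` A.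

Lemma residualS {T : topologicalType} (A B : set T) :
  A `<=` B -> residual A -> residual B.
Proof. by move=> AB [D oD DA]; exists D => //; exact: subset_trans AB. Qed.

Lemma residual_open {T : topologicalType} (U : set T) :
  open U -> dense U -> residual U.
Proof. by move=> oU dU; exists (fun=> U) => // t /(_ 0%N I). Qed.

Lemma residual_bigcap {T : topologicalType} (A : nat -> set T) :
  (forall k, residual (A k)) -> residual (\bigcap_k A k).
Proof.
move=> rA.
have /choice[D DP] k : exists D : nat -> set T,
    (forall l, open (D l) /\ dense (D l)) /\ \bigcap_l D l `<=` A k.
  by have [D oD DA] := rA k; exists D.
(* Codes of pairs enumerate the double family; [setT] fills the indices that code no pair. *)
exists (fun n => if unpickle n is Some kl then D kl.1 kl.2 else setT).
  move=> n; case: (unpickle n) => [kl|]; first exact: (DP kl.1).1.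
  by split; [exact: openT|move=> O O0 _; rewrite setIT].
move=> t Dt k _; apply: (DP k).2 => l _.
by have := Dt (pickle (k, l)) I; rewrite /= pickleK.
Qed.

Lemma residualI {T : topologicalType} (A B : set T) :
  residual A -> residual B -> residual (A `&` B).
Proof.
move=> rA rB; apply: residualS
    (@residual_bigcap _ (fun k => if k is 0%N then A else B) _).
  by move=> t AB; split; [exact: (AB 0%N)|exact: (AB 1%N)].
by case.
Qed.

(** [h] is its own continuous inverse, so it pulls dense open sets back to dense open sets. *)
Lemma residual_preimage_involution {T : topologicalType} {h : T -> T} :
  continuous h -> involutive h ->
  forall A : set T, residual A -> residual (h @^-1` A).
Proof.
move=> hc hK A [D oD DA]; have preim_open := (@continuousP _ _ h).1 hc.
exists (fun k => h @^-1` D k) => [k|t Dt]; last exact: DA.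
split; first exact/preim_open/(oD k).1.
move=> O [t Ot] oO.
have [|z [Oz Dz]] := (oD k).2 (h @^-1` O) _ (preim_open _ oO).
  by exists (h t); rewrite /= hK.
by exists (h z); split=> //=; rewrite hK.
Qed.

Definition baire_property {T : topologicalType} (A : set T) : Prop :=
  exists2 U, open U & residual [set t | A t <-> U t].

Lemma open_baire_property {T : topologicalType} (U : set T) :
  open U -> baire_property U.
Proof.
move=> oU; exists U => //; apply: (residualS setT) => //.
by apply: residual_open openT _ => O O0 _; rewrite setIT.
Qed.

(** The interior of the complement of [U] serves, since its union with [U] is open and dense. *)
Lemma baire_propertyC {T : topologicalType} (A : set T) :
  baire_property A -> baire_property (~` A).
Proof.
move=> [U oU rU]; exists (~` U)°; first exact: open_interior.
have dU : dense (U `|` (~` U)°).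
  move=> O [t Ot] oO; have [[z [Oz Uz]]|UO] := pselect (O `&` U !=set0).
    by exists z; split=> //; left.
  exists t; split=> //; right; rewrite /interior nbhsE.
  exists O => // z Oz Uz.
  by apply: UO; exists z.
have oUV : open (U `|` (~` U)°) by apply: openU => //; exact: open_interior.
have rUV := residualI _ _ rU (residual_open _ oUV dU).
apply: residualS rUV.
move=> t /= [[AU UA] UV]; split=> [nA|/interior_subset nU /AU//].
by case: UV => // /UA.
Qed.

Lemma baire_property_bigcup {T : topologicalType} (A : nat -> set T) :
  (forall k, baire_property (A k)) -> baire_property (\bigcup_k A k).
Proof.
move=> bA.
have /choice[U UP] k :
    exists U : set T, open U /\ residual [set t | A k t <-> U t].
  by have [U oU rU] := bA k; exists U.
exists (\bigcup_k U k); first by apply: bigcup_open => k _; exact: (UP k).1.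
apply: residualS (residual_bigcap _ (fun k => (UP k).2)) => t AU.
by split=> -[k _ /(AU k I)]; exists k.
Qed.

(** Baire category theorem: cylinders are shrunk into [D 0], [D 1], ... in turn, and their limit
    lies in all of these sets. *)
Lemma residual_dense (A : set cantor_space) : residual A -> dense A.
Proof.
move=> [D oD DA] O [x0 Ox0] oO.
have /nbhs_seqP[n0 x0O] : nbhs x0 O by exact: open_nbhs_nbhs.
have step (p : nat * (cantor_space * nat)) : exists q : cantor_space * nat,
    [/\ agree p.2.2 p.2.1 q.1, (p.2.2 < q.2)%N &
      forall y, agree q.2 q.1 y -> D p.1 y].
  case: p => k [x n] /=; have [oDk dDk] := oD k.
  have [|z [xz Dz]] := dDk _ _ (open_agree n x); first by exists x.
  have /nbhs_seqP[m zD] : nbhs z (D k) by exact: open_nbhs_nbhs.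
  exists (z, maxn m n.+1); split=> //=; first by rewrite leq_max ltnSn orbT.
  by move=> y /(agreeW (leq_maxl _ _))/zD.
have [s sP] := choice step.
pose c := fix c k := if k is k'.+1 then s (k', c k') else (x0, n0).
have cS k : [/\ agree (c k).2 (c k).1 (c k.+1).1, ((c k).2 < (c k.+1).2)%N &
    forall y, agree (c k.+1).2 (c k.+1).1 y -> D k y] := sP (k, c k).
have c_ge k : (k <= (c k).2)%N.
  by elim: k => // k IH; have [_ /(leq_ltn_trans IH)] := cS k.
have c_agree k l : agree (c k).2 (c k).1 (c (k + l)%N).1 /\
    ((c k).2 <= (c (k + l)%N).2)%N.
  elim: l => [|l [IH1 IH2]]; first by rewrite addn0.
  rewrite addnS; have [S1 S2 _] := cS (k + l)%N; split.
    exact: agree_trans IH1 (agreeW IH2 S1).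
  exact: leq_trans IH2 (ltnW S2).
(* Stage [i.+1] fixes at least [i.+1] coordinates, so coordinate [i] no longer changes after it. *)
pose y : cantor_space := fun i => (c i.+1).1 i.
have cy k : agree (c k).2 (c k).1 y.
  move=> i ik; rewrite /y; have [ki|ki] := leqP k i.+1.
    by have [] := c_agree k (i.+1 - k)%N; rewrite subnKC// => /(_ _ ik).
  have [+ _] := c_agree i.+1 (k - i.+1)%N; rewrite subnKC ?(ltnW ki)//.
  by move=> ->//; exact: leq_trans (c_ge i.+1).
exists y; split; first exact/x0O/(cy 0%N).
by apply: DA => k _; have [_ _] := cS k; apply; exact: cy.
Qed.

Lemma continuous_agree {h : cantor_space -> cantor_space} :
  (forall n, exists m, forall x y, agree m x y -> agree n (h x) (h y)) ->
  continuous h.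
Proof.
move=> hm x A /= /nbhs_seqP[n hxA]; have [m hmn] := hm n.
by apply/nbhs_seqP; exists m => y /hmn/hxA.
Qed.

(** * Lusin separation for a sigma-algebra containing the open sets *)

(** If no set of [S] separates the ranges, inseparable pairs of ever longer cylinders close in on
    some [x] and [y]; disjoint neighbourhoods of [f x] and [g y] then separate such a pair. *)
Lemma lusin_separation {T : topologicalType} (S : set_system T)
    (SC : forall A, S A -> S (~` A))
    (SU : forall A : nat -> set T, (forall k, S (A k)) -> S (\bigcup_k A k))
    (So : forall A, open A -> S A) (f g : baire_space -> T) :
  hausdorff_space T -> continuous f -> continuous g ->
  (forall x y, f x <> g y) ->
  exists C, [/\ S C, range f `<=` C & range g `<=` ~` C].
Proof.
move=> hT fc gc fg.
pose sep A B := exists C, [/\ S C, A `<=` C & B `<=` ~` C].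
have sep_bigcup (A B : nat -> set T) : (forall i j, sep (A i) (B j)) ->
    sep (\bigcup_i A i) (\bigcup_j B j).
  move=> AB.
  have /choice[C CP] (ij : nat * nat) :
      exists C, [/\ S C, A ij.1 `<=` C & B ij.2 `<=` ~` C] := AB ij.1 ij.2.
  (* The union over [i] of the intersections over [j] of [C (i, j)], spelled with the operations
     that [S] allows. *)
  exists (\bigcup_i ~` \bigcup_j ~` C (i, j)); split.
  - apply: (SU) => i; apply: (SC); apply: SU => j; apply: SC.
    by have [] := CP (i, j).
  - move=> t [i _ At]; exists i => // -[j _]; apply.
    by have [_ + _] := CP (i, j); exact.
  - move=> t [j _ Bt] [i _]; apply; exists j => //.
    by have [_ _] := CP (i, j); exact.
pose cyl (u : baire_space -> T) s : set T :=
  [set u x | x in [set x : baire_space | mkseq x (size s) = s]].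
have cylS u s : cyl u s = \bigcup_i cyl u (rcons s i).
  apply/seteqP; split=> [t [x /= xs <-]|t [i _ [x /= xs <-]]].
    exists (x (size s)) => //; exists x => //=.
    by rewrite size_rcons mkseqS xs.
  exists x => //=; move: xs; rewrite size_rcons mkseqS.
  by move=> /rcons_inj[].
suff sep0 : sep (cyl f [::]) (cyl g [::]).
  have [C [SC' fC gC]] := sep0; exists C; split=> // t [x _ <-].
    by apply: fC; exists x.
  by apply: gC; exists x.
apply: contrapT => nsep0.
have step (p : seq nat * seq nat) : exists ij : nat * nat,
    ~ sep (cyl f p.1) (cyl g p.2) ->
    ~ sep (cyl f (rcons p.1 ij.1)) (cyl g (rcons p.2 ij.2)).
  have [?|nsep] := pselect (sep (cyl f p.1) (cyl g p.2)).
    by exists (0, 0)%N.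
  apply: contrapT => nstep; apply: nsep; rewrite (cylS f p.1) (cylS g p.2).
  apply: sep_bigcup => i j; apply: contrapT => nij.
  by apply: nstep; exists (i, j).
have [e eP] := choice step.
pose b := fix b k := if k is k'.+1
  then (rcons (b k').1 (e (b k')).1, rcons (b k').2 (e (b k')).2)
  else ([::], [::]) : seq nat * seq nat.
have b_sep k : ~ sep (cyl f (b k).1) (cyl g (b k).2).
  by elim: k => // k; exact: eP.
pose x : baire_space := fun k => (e (b k)).1.
pose y : baire_space := fun k => (e (b k)).2.
have bE k : b k = (mkseq x k, mkseq y k).
  by elim: k => // k IH; rewrite !mkseqS /= /x /y {1 3}IH.
move: hT; rewrite open_hausdorff => /(_ (f x) (g y)).
case=> [|[U V] /= [/set_mem Ux /set_mem Vy] [oU oV /eqP UV]].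
  exact/eqP/fg.
have /fc/nbhs_seqP[m xU] : nbhs (f x) U by exact: open_nbhs_nbhs.
have /gc/nbhs_seqP[n yV] : nbhs (g y) V by exact: open_nbhs_nbhs.
apply: (b_sep (maxn m n)); rewrite bE; exists U; split; first exact: So.
- move=> _ [z /= + <-]; rewrite size_mkseq => /esym/eq_mkseq_agree xz.
  exact/xU/(agreeW (leq_maxl m n)).
- move=> _ [z /= + <-] Uz; rewrite size_mkseq => /esym/eq_mkseq_agree yz.
  have Vz : V (g z) by exact/yV/(agreeW (leq_maxr m n)).
  by rewrite -[False]/(set0 (g z)) -UV.
Qed.

(** * Nonprincipal ultrafilters and the Baire property *)

Lemma not_ultra_finite (Q : set_system nat) : UltraFilter Q ->
  (forall n, ~ Q [set n]) -> forall n, ~ Q `I_n.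
Proof.
move=> QU Q1; elim=> [|n IH].
  by rewrite II0; exact: filter_not_empty.
rewrite IIS => Qn.
have [//|Qc] := in_ultra_setVsetC [set n] QU; first exact: Q1.
apply: IH; apply: filterS (filterI Qn Qc).
by move=> k [[]].
Qed.

Definition flip (n : nat) (c : cantor_space) : cantor_space :=
  fun i => if (i < n)%N then c i else ~~ c i.

Lemma flipK (n : nat) : involutive (flip n).
Proof.
by move=> c; apply: funext => i; rewrite /flip; case: (i < n)%N; rewrite ?negbK.
Qed.

Lemma flip_continuous (n : nat) : continuous (flip n).
Proof.
apply: continuous_agree => m; exists m => x y xy i im.
by rewrite /flip xy.
Qed.

(* On an open set where [Q] is either residual or meager, a generic [z] and its
   [flip n z] both belong to [Q], or neither does; but their intersection, and
   that of their complements, is finite. *)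
Lemma ultra_not_baire_property (Q : set_system nat) : UltraFilter Q ->
  (forall n, ~ Q [set n]) -> ~ baire_property (cantor_family Q).
Proof.
move=> QU Q1 [U oU rU].
have Qfin := not_ultra_finite Q QU Q1.
have rflip n := residualI _ _ rU
  (residual_preimage_involution (flip_continuous n) (flipK n) _ rU).
have [[x Ux]|U0] := pselect (U !=set0).
  have /nbhs_seqP[n xU] : nbhs x U by exact: open_nbhs_nbhs.
  have [|z [xz [/= [_ Qz] [_ Qfz]]]] :=
    residual_dense _ (rflip n) _ _ (open_agree n x).
    by exists x.
  have xfz : agree n x (flip n z) by move=> i ni; rewrite /flip ni xz.
  apply: (Qfin n); apply: filterS (filterI (Qz (xU _ xz)) (Qfz (xU _ xfz))).
  by move=> i /= []; rewrite /flip; case: ifP => // _ ->.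
(* Here [Q] is meager; [flip 0 z] is the complement of [z], so one of the two lies in [Q]. *)
have [|z [_ [/= [Qz _] [Qfz _]]]] := residual_dense _ (rflip 0%N) _ _ openT.
  by exists (fun=> true).
have [Qz'|Qz'] := in_ultra_setVsetC [set n | z n] QU.
  by apply: U0; exists z; exact: Qz.
apply: U0; exists (flip 0 z); apply: Qfz.
by apply: filterS Qz' => i /negP.
Qed.

(** * Images of ultrafilters and points of [beta_omega] *)

Lemma ultra_pushforward {S T : Type} (h : S -> T) (P : set_system S) :
  UltraFilter P -> UltraFilter [set B | P (h @^-1` B)].
Proof.
move=> PU; have hP : ProperFilter [set B | P (h @^-1` B)].
  exact: (fmap_proper_filter h).
split=> // G GF PG; apply/seteqP; split=> [B GB|]; last exact: PG.
have [//|PBc] := in_ultra_setVsetC (h @^-1` B) PU.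
have GBc : G (~` B) by exact: PG.
by have [? []] := filter_ex (filterI GB GBc).
Qed.

Lemma beta_hat_nbhs (p : beta_omega) (A : set nat) :
  beta_ultra p A -> nbhs p (beta_hat A).
Proof.
move=> pA; apply: open_nbhs_nbhs; split=> //.
by exists [set A]; [move=> ?|rewrite bigcup_set1].
Qed.

(** Ultrafilters are maximal, so inclusion of [p] in [q] would force equality. *)
Lemma beta_omega_separate (p q : beta_omega) :
  p <> q -> exists2 A, beta_ultra p A & ~ beta_ultra q A.
Proof.
case: p q => [p pU] [q qU] pq; apply: contrapT => npq; apply: pq.
suff pq : p = q.
  case: q / pq qU {npq} => qU.
  by congr BetaOmega; exact: Prop_irrelevance.
apply/esym; apply: max_filter => A pA.
by apply: contrapT => nqA; apply: npq; exists A.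
Qed.

Lemma ex_first_exit (U : nat -> set nat) : exists h : nat -> nat,
  forall n m, ~ U n m -> ~ U (h m) m /\ (h m <= n)%N.
Proof.
suff /choice[h hP] m : exists k, forall n, ~ U n m -> ~ U k m /\ (k <= n)%N.
  by exists h => n m; exact: hP.
have [ex|all] := pselect (exists n, `[< ~ U n m >]).
  exists (ex_minn ex); case: ex_minnP => k /asboolP Uk kmin n nU.
  by split=> //; apply: kmin; exact/asboolP.
(* A point lying in every [U n] has no exit; 0 is an arbitrary value there. *)
by exists 0%N => n nU; exfalso; apply: all; exists n; exact/asboolP.
Qed.

(* [F] is any proper filter other than a principal ultrafilter; in particular
   every proper filter containing the cofinite sets is covered. For the
   principal ultrafilter at [n], every sequence [x] converges to [x n]. *)
Theorem corollary2p2 (F : set_system nat) (FF : ProperFilter F)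
    (Fnp : forall n : nat, ~ F [set n])
    (Fan : analytic (cantor_family F)) :
  ~ exists x : nat -> beta_omega,
      injective x /\ exists p : beta_omega, x @ F --> p.
Proof.
move=> [x [xinj [p xp]]].
have pU := beta_ultraP p; have xU n := beta_ultraP (x n).
have Flim A : beta_ultra p A -> F [set n | beta_ultra (x n) A].
  by move=> /beta_hat_nbhs/xp.
(* By injectivity at most one [n] has [x n = p], and no singleton is in [F]. *)
have FN (A : set nat) : A `<=` [set n | x n = p] -> ~ F A.
  move=> AN FA; have [n An] := filter_ex FA.
  apply: (Fnp n); apply: filterS FA => m Am.
  by apply: xinj; rewrite (AN _ Am) (AN _ An).
have /choice[U UP] n : exists A, beta_ultra p A /\
    (x n <> p -> ~ beta_ultra (x n) A).
  have [xnp|xnp] := pselect (x n = p).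
    by exists setT; split; first exact: filterT.
  by have [A pA xA] := beta_omega_separate _ _ (nesym xnp); exists A.
have [h hP] := ex_first_exit U.
pose Q : set_system nat := [set B | beta_ultra p (h @^-1` B)].
have QU : UltraFilter Q by exact: ultra_pushforward.
have pUI n : beta_ultra p [set m | forall i, (i < n)%N -> U i m].
  elim: n => [|n IH]; first by apply: filterS filterT.
  apply: filterS (filterI IH (UP n).1) => m [Um Unm] i.
  by rewrite ltnS leq_eqVlt => /predU1P[->//|/Um].
(* If some [x n <> p] contained the set of points of [U 0], ..., [U k] at which [h] is [k], a point
   [m] of it outside [U n] would satisfy [h m = k] and so lie outside [U k]. *)
have QNP k : ~ Q [set k].
  rewrite /Q/= => pk.
  apply: (FN _ _ (Flim _ (filterI pk (pUI k.+1)))) => n /= xn.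
  apply: contrapT => /((UP n).2) nUn.
  have [//|xUc] := in_ultra_setVsetC (U n) (xU n).
  have [m [[/= hm Um] nU]] := filter_ex (filterI xn xUc).
  by have [+ _] := hP _ _ nU; apply; apply: (Um (h m)); rewrite hm.
(* When [x n <> p], the complement of [U n] is in [x n] and [h] is at most [n] on it, so the image
   of [x n] is an ultrafilter with a finite member, hence principal. *)
have /choice[g gP] n : exists k, x n <> p -> beta_ultra (x n) (h @^-1` [set k]).
  have [xnp|xnp] := pselect (x n = p); first by exists 0%N.
  have xnU : UltraFilter [set B | beta_ultra (x n) (h @^-1` B)].
    exact: ultra_pushforward.
  apply: contrapT => nk; apply: (not_ultra_finite _ xnU _ n.+1).
    by move=> k xk; apply: nk; exists k.
  have [//|xUc] := in_ultra_setVsetC (U n) (xU n).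
    by have := (UP n).2 xnp.
  by apply: filterS xUc => m /hP[_ /=]; rewrite ltnS.
(* Where [x n = p] the value [g n] is a mere default, so that index is always included, as [QF]
   requires. *)
pose Psi (c : cantor_space) : cantor_space :=
  fun n => `[< x n = p >] || c (g n).
have QF (c : cantor_space) : Q [set k | c k] -> cantor_family F (Psi c).
  move=> /Flim; apply: filterS => n /= xc.
  rewrite /Psi; apply/orP; have [xnp|xnp] := pselect (x n = p).
    by left; exact/asboolP.
  by right; have [m [/= ->]] := filter_ex (filterI (gP _ xnp) xc).
have Psic : continuous Psi.
  apply: continuous_agree => n; exists (\max_(i < n) (g i).+1) => c d cd i ni.
  rewrite /Psi cd//.
  exact: (@leq_bigmax _ (fun i : 'I_n => (g i).+1) (Ordinal ni)).
have [F0|[f fc fF]] := Fan.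
  have : cantor_family F (fun=> true) by apply: filterS filterT.
  by rewrite F0.
(* Complementation away from the index with [x n = p]; it carries [F] to a second analytic set,
   which holds [Psi c] for every [c] outside [Q]. *)
pose dual (c : cantor_space) : cantor_space :=
  fun n => `[< x n = p >] || ~~ c n.
have dualc : continuous dual.
  by apply: continuous_agree => n; exists n => c d cd i ni; rewrite /dual cd.
have Ff z : cantor_family F (f z) by rewrite -fF; exists z.
have PsiN (c : cantor_space) : ~ Q [set k | c k] ->
    exists2 d, cantor_family F d & dual d = Psi c.
  move=> nQc; exists (Psi (fun k => ~~ c k)).
    apply: QF; have [//|] := in_ultra_setVsetC [set k | c k] QU.
    by apply: filterS => k /negP.
  apply: funext => n; rewrite /dual /Psi; case: `[< x n = p >] => //=.
  by rewrite negbK.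
have Psi_continuous_open := (@continuousP _ _ Psi).1 Psic.
(* The Baire property does not pull back along [Psi], whence this sigma-algebra
   instead of that of the sets with the Baire property. *)
have [||||||z w fzw|C [CP FC GC]] := lusin_separation
    [set C | baire_property (Psi @^-1` C)] _ _ _ f (dual \o f).
- by move=> A /baire_propertyC.
- by move=> A bA; rewrite /= preimage_bigcup; exact: baire_property_bigcup.
- by move=> A /Psi_continuous_open/open_baire_property.
- exact: cantor_space_hausdorff.
- exact: fc.
- by move=> z; apply: continuous_comp; [exact: fc|exact: dualc].
(* A common point would give two sets in [F] that meet only where [x n = p]. *)
- apply: (FN _ _ (filterI (Ff z) (Ff w))) => n [/=].
  by rewrite fzw /dual/= => /orP[/asboolP//|/negP].
apply: (ultra_not_baire_property Q QU QNP).
suff -> : cantor_family Q = Psi @^-1` C by [].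
apply/seteqP; split=> c /=.
  by move=> /QF; rewrite -fF => -[z _ <-]; apply: FC; exists z.
move=> Cc; apply: contrapT => /PsiN[d + dc]; rewrite -fF => -[z _ fz].
by apply: (GC _ _ Cc); exists z => //=; rewrite fz.
Qed.
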